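(* Let $\mathbb{F}$ be an algebraically closed field with $\mathrm{Char}(\mathbb{F})\neq 2$. Up to isomorphism there exist exactly two non-trivial $2$-dimensional unital algebras over $\mathbb{F}$, given by their matrices of structure constants (MSC) as follows: $$A_{2}\left(\tfrac{1}{2},0,\tfrac{1}{2}\right)=\left(\begin{array}{cccc}\frac{1}{2} & 0 & 0 & 1\\ 0 & \frac{1}{2} & \frac{1}{2} & 0\end{array}\right),\qquad A_{4}\left(\tfrac{1}{2},\tfrac{1}{2}\right)=\left(\begin{array}{cccc}\frac{1}{2} & 0 & 0 & 0\\ 0 & \frac{1}{2} & \frac{1}{2} & 0\end{array}\right).$$
   Context: An algebra over a field $\mathbb{F}$ is a vector space $\mathbb{A}$ with a bilinear multiplication (not assumed associative or commutative). It is non-trivial if its multiplication is not identically zero. For a $2$-dimensional algebra with basis $(e_1,e_2)$, its matrix of structure constants (MSC) is the $2\times 4$ matrix $A=\left(\begin{array}{cccc}\alpha_1&\alpha_2&\alpha_3&\alpha_4\\ \beta_1&\beta_2&\beta_3&\beta_4\end{array}\right)$ over $\mathbb{F}$ with $e_1e_1=\alpha_1e_1+\beta_1e_2$, $e_1e_2=\alpha_2e_1+\beta_2e_2$, $e_2e_1=\alpha_3e_1+\beta_3e_2$, $e_2e_2=\alpha_4e_1+\beta_4e_2$. An algebra is identified with its MSC. Two algebras with MSCs $A$ and $B$ are isomorphic iff $B=gA(g^{-1})^{\otimes 2}$ for some $g\in GL(2;\mathbb{F})$, with $\otimes$ the Kronecker product. An algebra $\mathbb{A}$ is unital if there is an element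 $\mathbf{1}\in\mathbb{A}$ with $\mathbf{1}\cdot\mathbf{u}=\mathbf{u}\cdot\mathbf{1}=\mathbf{u}$ for all $\mathbf{u}\in\mathbb{A}$. The symbols $A_2(\cdot),A_4(\cdot)$ are just names for the displayed matrices. *)

(* Defs.v *)
From HB Require Import structures.
From mathcomp Require Import all_boot all_order all_algebra.
From mathcomp Require Import sesquilinear mxtens.

Set Implicit Arguments.
Unset Strict Implicit.
Unset Printing Implicit Defensive.

Import GRing.Theory.
Local Open Scope ring_scope.

(* Finite-dimensional algebras; the multiplication need be neither associative
   nor commutative, and need not have a unit. *)
Record algebra (F : fieldType) := Algebra {
  carrier :> vectType F;
  amul : {bilinear carrier -> carrier -> carrier}
}.

Section Algebras.
Variable F : fieldType.
Implicit Types V W : algebra F.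

Definition nontrivial V := exists u v : V, amul V u v != 0.

Definition unital V :=
  exists e : V, forall u : V, amul V e u = u /\ amul V u e = u.

Definition isomorphic V W :=
  exists2 f : {linear V -> W},
    bijective f & forall u v : V, f (amul V u v) = amul W (f u) (f v).

End Algebras.

Section StructureConstants.
Variable F : fieldType.

(* Matrices of structure constants, of size 2 x 4.  The columns are numbered by mxtens_index (i, j) = 2 i + j,
   so they come in the order e1e1, e1e2, e2e1, e2e2, and column (i, j) holds
   the coordinates of the product of the i-th and j-th basis vectors
   (msc_mul_basis below). *)
Definition msc := 'M[F]_(2, 2 * 2).

(* Products of coordinate columns: u v = A (u (x) v), (x) being the Kronecker
   product; the type of the latter, 'M_(2 * 2, 1 * 1), is 'cV_(2 * 2). *)
Definition msc_mul (A : msc) (u v : 'cV[F]_2) : 'cV[F]_2 := A *m (tensmx u v).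

Lemma msc_mul_is_bilinear (A : msc) :
  bilinear_for *:%R *:%R (msc_mul A).
Proof.
by split=> [v|u] a x y; rewrite /msc_mul -[RHS]/(a *: (A *m _) + A *m _);
  rewrite scalemxAr -mulmxDr; congr (_ *m _); apply/matrixP=> i j;
  rewrite !mxE ?mulrDl ?mulrDr ?mulrA // [_ * a]mulrC.
Qed.

HB.instance Definition _ (A : msc) :=
  bilinear_isBilinear.Build F 'cV[F]_2 'cV[F]_2 'cV[F]_2 _ _ (msc_mul A)
    (msc_mul_is_bilinear A).

Definition msc_algebra (A : msc) : algebra F :=
  @Algebra F 'cV[F]_2 (msc_mul A).

Lemma tensmx_delta (i j : 'I_2) :
  @tensmx F 2 1 2 1 (delta_mx i 0) (delta_mx j 0)
    = delta_mx (mxtens_index (i, j)) 0.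
Proof.
apply/matrixP=> k l; case: (mxtens_indexP k) => i' j'.
rewrite !mxE mxtens_indexK /= !ord1 !andbT -natrM mulnb.
by rewrite (can_eq (@mxtens_indexK 2 2)).
Qed.

Lemma msc_mul_basis (A : msc) (i j : 'I_2) :
  amul (msc_algebra A) (delta_mx i 0) (delta_mx j 0)
    = col (mxtens_index (i, j)) A.
Proof. by rewrite /= /msc_mul tensmx_delta colE. Qed.

Lemma tensmx1 : tensmx 1%:M 1%:M = 1%:M :> 'M[F]_(2 * 2).
Proof.
apply/matrixP=> k l; case: (mxtens_indexP k) => i j.
case: (mxtens_indexP l) => i' j'.
by rewrite tensmxE !mxE -natrM mulnb (can_eq (@mxtens_indexK 2 2)).
Qed.

Lemma isomorphic_mscP (A B : msc) :
  isomorphic (msc_algebra A) (msc_algebra B) <->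
  exists2 g : 'M[F]_2,
    g \in unitmx & B = g *m A *m tensmx (invmx g) (invmx g).
Proof.
have tensVr (g : 'M[F]_2) : g \in unitmx ->
    tensmx g g *m tensmx (invmx g) (invmx g) = 1%:M.
  by move=> gU; rewrite tensmx_mul mulmxV // tensmx1.
have tensVl (g : 'M[F]_2) : g \in unitmx ->
    tensmx (invmx g) (invmx g) *m tensmx g g = 1%:M.
  by move=> gU; rewrite tensmx_mul mulVmx // tensmx1.
split=> [[f [h fK hK] fM] | [g gU ->]].
  pose mx (p : 'cV[F]_2 -> 'cV[F]_2) : 'M[F]_2 :=
    \matrix_(i, j) p (delta_mx j 0) i 0.
  have mxD p j : mx p *m delta_mx j 0 = p (delta_mx j 0).
    by rewrite -colE; apply/matrixP=> i l; rewrite !mxE ord1.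
  have fE (u : 'cV[F]_2) : f u = mx f *m u.
    rewrite (matrix_sum_delta u) linear_sum mulmx_sumr; apply: eq_bigr => i _.
    rewrite linear_sum mulmx_sumr; apply: eq_bigr => j _.
    by rewrite linearZ -scalemxAr ord1 mxD.
  have gU : mx f \in unitmx.
    suff fh1 : mx f *m mx h = 1%:M by case: (mulmx1_unit fh1).
    apply/matrixP=> i j.
    transitivity ((mx f *m mx h *m delta_mx j (0 : 'I_1)) i 0).
      by rewrite -colE [RHS]mxE.
    by rewrite -mulmxA mxD -fE hK !mxE eqxx andbT.
  exists (mx f) => //.
  suff -> : mx f *m A = B *m tensmx (mx f) (mx f).
    by rewrite -mulmxA tensVr // mulmx1.
  apply/matrixP=> k l; case: (mxtens_indexP l) => i j.
  have /matrixP/(_ k 0) := fM (delta_mx i 0) (delta_mx j 0).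
  rewrite !fE /= /msc_mul -tensmx_mul tensmx_delta !mulmxA.
  by rewrite -!colE !mxE.
exists (mulmx g : {linear 'cV[F]_2 -> 'cV[F]_2}).
  by exists (mulmx (invmx g)) => u; [apply: mulKmx | apply: mulKVmx].
move=> u v; rewrite /= /msc_mul -tensmx_mul !mulmxA.
by rewrite -(mulmxA (g *m A)) tensVl // mulmx1.
Qed.

Definition msc_of_rows (r1 r2 : seq F) : msc :=
  \matrix_(i, j) nth 0 (nth [::] [:: r1; r2] i) j.

Definition A2 : msc :=
  msc_of_rows [:: 1 / 2;     0;     0; 1]
              [::     0; 1 / 2; 1 / 2; 0].

Definition A4 : msc :=
  msc_of_rows [:: 1 / 2;     0;     0; 0]
              [::     0; 1 / 2; 1 / 2; 0].

End StructureConstants.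
Arguments A2 {F}.
Arguments A4 {F}.

(* Main.v *)
(* Complete the unit e to a basis (e, w) and write w w = a e + b w.  Completing
   the square, v = w - (b/2) e satisfies v v = d e.  If d = 0, then (e/2, v) is a
   basis with structure constants A4; otherwise v can be rescaled by a square
   root of 1/(2d), and the structure constants become A2.  The two algebras
   differ in that only A4 has a nonzero element of square zero. *)
From HB Require Import structures.
Require Import Defs.
From mathcomp Require Import all_boot all_order all_algebra.
From mathcomp Require Import sesquilinear mxtens.
From mathcomp Require Import ring.

Set Implicit Arguments.
Unset Strict Implicit.
Unset Printing Implicit Defensive.

Import GRing.Theory.
Local Open Scope ring_scope.

Lemma amul_sum (F : fieldType) (V : algebra F) (n : nat) (a b : 'I_n -> F)
    (x y : 'I_n -> V) :
  amul V (\sum_i a i *: x i) (\sum_j b j *: y j)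
    = \sum_i \sum_j (a i * b j) *: amul V (x i) (y j).
Proof.
rewrite (linear_sumlz (amul V)); apply: eq_bigr => i _.
rewrite (linear_sumr (amul V)); apply: eq_bigr => j _.
by rewrite (linearZl_LR (amul V)) (linearZr_LR (amul V)) scalerA.
Qed.

(** The coordinate map of the basis [X] is the isomorphism: it sends [X] to the standard basis, and
    bilinearity reduces multiplicativity to products of basis vectors. *)
Lemma isomorphic_msc_basis (F : fieldType) (V : algebra F) (A : msc F)
    (X : 2.-tuple V) :
    basis_of fullv X ->
    (forall i j : 'I_2, amul V X`_i X`_j
       = \sum_k A k (mxtens_index (i, j)) *: X`_k) ->
  isomorphic V (msc_algebra A).
Proof.
move=> Xbasis XM; have Xfree := basis_free Xbasis.
pose f (v : V) : 'cV[F]_2 := \col_i coord X i v.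
have f_linear : linear f by move=> a u v; apply/colP=> i; rewrite !mxE linearP.
pose fL : {linear V -> msc_algebra A} :=
  HB.pack f (GRing.isLinear.Build F V 'cV[F]_2 _ f f_linear).
have fX (i : 'I_2) : fL X`_i = delta_mx i 0.
  by apply/colP=> j; rewrite !mxE coord_free // eqxx andbT eq_sym.
have expand (v : V) : v = \sum_i coord X i v *: X`_i.
  exact: coord_basis Xbasis (memvf v).
exists fL.
  exists (fun x : 'cV[F]_2 => \sum_i x i 0 *: X`_i) => [v | x].
    by rewrite [RHS]expand; apply: eq_bigr => i _; rewrite mxE.
  by apply/colP=> i; rewrite mxE coord_sum_free.
have fLsum (c : 'I_2 -> F) : fL (\sum_i c i *: X`_i) = \sum_i c i *: fL X`_i.
  by rewrite linear_sum; apply: eq_bigr => i _; rewrite linearZ.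
move=> u v; rewrite (expand u) (expand v) amul_sum !fLsum amul_sum linear_sum.
apply: eq_bigr => i _; rewrite linear_sum; apply: eq_bigr => j _.
rewrite linearZ XM fLsum !fX msc_mul_basis; congr (_ *: _).
apply/colP=> k; rewrite summxE [RHS]mxE (bigD1 k) // fX !mxE !eqxx mulr1.
rewrite big1 => [|l lk]; first by rewrite [LHS]addr0.
by rewrite fX !mxE eq_sym (negPf lk) mulr0.
Qed.

(* The algebra with unit [2 e1] in which [e2 e2 = t e1]: [A2] is the case
   [t = 1] and [A4] the case [t = 0]. *)
Definition unital_msc (F : fieldType) (t : F) : msc F :=
  msc_of_rows [:: 1 / 2;     0;     0; t]
              [::     0; 1 / 2; 1 / 2; 0].

Lemma unital_msc_mulE (F : fieldType) (t : F) (u v : 'cV[F]_2) :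
  let w := amul (msc_algebra (unital_msc t)) u v in
  w 0 0 = u 0 0 * v 0 0 / 2 + t * u 1 0 * v 1 0 /\
  w 1 0 = (u 0 0 * v 1 0 + u 1 0 * v 0 0) / 2.
Proof.
have E (A : msc F) k : (A *m tensmx u v) k 0
    = \sum_(i < 2) \sum_(j < 2) A k (mxtens_index (i, j)) * (u i 0 * v j 0).
  rewrite mxE pair_bigA.
  (* The product with [tensmx u v] sums over columns; [mxtens_index] turns this into a sum over
     pairs (i, j). *)
  rewrite (reindex (@mxtens_index 2 2)) /=; last by
    exists (@mxtens_unindex 2 2) => i _; rewrite ?mxtens_indexK ?mxtens_unindexK.
  apply: eq_bigr => -[i j] _; rewrite [tensmx _ _ _ _]mxE mxtens_indexK /=.
  by rewrite !ord1.
rewrite /= /msc_mul !E !big_ord_recl !big_ord0 !mxE /=.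
have -> : lift ord0 ord0 = 1 :> 'I_2 by apply: val_inj.
split; ring.
Qed.

Lemma ord2_cases (i : 'I_2) : i = 0 \/ i = 1.
Proof. by case: i => [[|[|//]] ilt]; [left | right]; apply: val_inj. Qed.

Lemma unital_unital_msc (F : fieldType) (t : F) :
  2%:R != 0 :> F -> unital (msc_algebra (unital_msc t)).
Proof.
move=> two_neq0; exists (2%:R *: delta_mx 0 0 : 'cV[F]_2) => u.
have [l0 l1] := unital_msc_mulE t (2%:R *: delta_mx 0 0) u.
have [r0 r1] := unital_msc_mulE t u (2%:R *: delta_mx 0 0).
by split; apply/colP=> i; case: (ord2_cases i) => ->;
  rewrite ?l0 ?l1 ?r0 ?r1 !mxE /=; field.
Qed.

Lemma nontrivial_unital_msc (F : fieldType) (t : F) :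
  2%:R != 0 :> F -> nontrivial (msc_algebra (unital_msc t)).
Proof.
move=> /(unital_unital_msc t)[e eP].
exists e, (delta_mx 0 0 : 'cV[F]_2); rewrite (eP _).1.
by apply/eqP=> /colP/(_ 0)/eqP; rewrite !mxE oner_eq0.
Qed.

(** An isomorphism invariant, used to separate [A2] from [A4]: a square-zero element of [W] pulls
    back to one of [V]. *)
Lemma isomorphic_square_zero (F : fieldType) (V W : algebra F) :
  isomorphic V W -> (forall u : V, amul V u u = 0 -> u = 0) ->
  forall w : W, amul W w w = 0 -> w = 0.
Proof.
move=> [f [g fK gK] fM] V_red w ww0.
rewrite -(gK w) (V_red (g w)) ?linear0 //.
by apply: (can_inj fK); rewrite fM gK ww0 linear0.
Qed.

(** The square of (x, y) is (x^2/2 + y^2, x y). Its second coordinate forces x = 0 or y = 0, and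
    then the first kills the other one. *)
Lemma A2_square_zero (F : fieldType) (u : msc_algebra (@A2 F)) :
  2%:R != 0 :> F -> amul _ u u = 0 -> u = 0.
Proof.
move=> two_neq0 uu0; have [] := unital_msc_mulE 1 u u.
rewrite -[unital_msc 1]/A2 uu0 !mxE => e0 e1.
have /eqP : u 0 0 * u 1 0 = 0 by rewrite [RHS]e1; field.
rewrite mulf_eq0 => u01.
have [u0 u1] : u 0 0 = 0 /\ u 1 0 = 0.
  case/orP: u01 => /eqP u_0; split=> //; move/esym/eqP: e0; rewrite u_0.
    by rewrite !mul0r add0r mul1r mulf_eq0 orbb => /eqP.
  by rewrite mulr0 addr0 !mulf_eq0 orbb invr_eq0 (negPf two_neq0) orbF => /eqP.
apply/colP=> i; rewrite mxE.
by case: (ord2_cases i) => ->.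
Qed.

Lemma A2_A4_not_isomorphic (F : fieldType) :
  2%:R != 0 :> F -> ~ isomorphic (msc_algebra (@A2 F)) (msc_algebra (@A4 F)).
Proof.
move=> two_neq0 /isomorphic_square_zero iso.
(* The second basis vector of [A4] squares to zero, so the invariant would make it vanish. *)
have /colP/(_ 1)/eqP : (delta_mx 1 0 : 'cV[F]_2) = 0.
  apply: iso => [u|]; first exact: A2_square_zero.
  rewrite msc_mul_basis.
  by apply/colP=> i; case: (ord2_cases i) => ->; rewrite !mxE.
by rewrite !mxE oner_eq0.
Qed.

Lemma basis_of_pair (F : fieldType) (V : vectType F) (u v : V) :
    \dim {:V} = 2%N -> u != 0 -> v \notin <[u]>%VS ->
  basis_of {:V} [:: u; v].
Proof.
move=> dimV u_neq0 v_notin.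
rewrite basisEfree subvf dimV andbT.
(* [free_cons] tests the head against the span of the tail, so [v] has to come first. *)
rewrite (perm_free (permEl (perm_catC [:: u] [:: v]))) /= free_cons.
by rewrite span_seq1 v_notin seq1_free.
Qed.

(** The unit of [unital_msc t] is twice the first basis vector, so the basis to take is (e/2, v);
    the factor t/2 arises because t (e/2) = (t/2) e. *)
Lemma isomorphic_unital_msc (F : fieldType) (V : algebra F) (e v : V) (t : F) :
    2%:R != 0 :> F -> \dim {: V} = 2%N ->
    (forall u, amul V e u = u /\ amul V u e = u) ->
    e != 0 -> v \notin <[e]>%VS -> amul V v v = (t / 2%:R) *: e ->
  isomorphic V (msc_algebra (unital_msc t)).
Proof.
move=> two_neq0 dimV eP e_neq0 v_notin vv.
pose X := [tuple 2%:R^-1 *: e; v].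
have Xbasis : basis_of fullv X.
  apply: basis_of_pair; rewrite ?scaler_eq0 ?invr_eq0 ?negb_or ?two_neq0 //.
  apply: contra v_notin => /vlineP[k ->].
  by rewrite scalerA memvZ ?memv_line.
apply: (isomorphic_msc_basis Xbasis) => i j.
rewrite !big_ord_recl big_ord0 !mxE.
case: i j => [[|[|//]] ilt] [[|[|//]] jlt] /=;
  rewrite ?(linearZl_LR (amul V)) ?(linearZr_LR (amul V)) ?(eP _).1 ?(eP _).2;
  rewrite ?scale0r ?add0r ?addr0 ?mul1r ?scalerA //.
Qed.

Lemma unital_square_scalar (F : fieldType) (V : algebra F) (e : V) :
    2%:R != 0 :> F -> \dim {: V} = 2%N ->
    (forall u, amul V e u = u /\ amul V u e = u) -> e != 0 ->
  exists2 v : V, v \notin <[e]>%VS & exists d, amul V v v = d *: e.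
Proof.
move=> two_neq0 dimV eP e_neq0.
have /subvPn[w _ w_notin] : ~~ (fullv <= <[e]>)%VS.
  by apply/negP=> /dimvS; rewrite dimV dim_vline e_neq0.
have ww := coord_basis (X := [tuple e; w]) (basis_of_pair dimV e_neq0 w_notin)
  (memvf (amul V w w)).
move: ww; rewrite !big_ord_recl big_ord0 /= addr0.
move: (coord _ _ _) (coord _ _ _) => b a ww.
(* As w w = a e + b w, the two cross terms contribute - b w, which leaves (a + (b/2)^2) e. *)
exists (w - (b / 2%:R) *: e).
  apply: contra w_notin => v_in; rewrite -(subrK ((b / 2%:R) *: e) w).
  by rewrite memvD // memvZ ?memv_line.
exists (a + (b / 2%:R) ^+ 2).
rewrite (linearBl (amul V)) !(linearBr (amul V)) !(linearZl_LR (amul V)).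
rewrite !(linearZr_LR (amul V)) !(eP _).1 (eP _).2 ww.
have {ww}-> : b *: w = (b / 2%:R) *: w + (b / 2%:R) *: w.
  by rewrite -scalerDl; congr (_ *: _); field.
by rewrite addrA addrK opprB addrACA subrr addr0 scalerA -expr2 -scalerDl.
Qed.

Theorem corollary4p3 (F : closedFieldType) (charF : 2%N \notin [pchar F]) :
  [/\ [/\ \dim {: msc_algebra (@A2 F)} = 2%N,
          nontrivial (msc_algebra (@A2 F)) & unital (msc_algebra (@A2 F))],
      [/\ \dim {: msc_algebra (@A4 F)} = 2%N,
          nontrivial (msc_algebra (@A4 F)) & unital (msc_algebra (@A4 F))],
      ~ isomorphic (msc_algebra (@A2 F)) (msc_algebra (@A4 F))
    & forall V : algebra F,
        \dim {: V} = 2%N -> nontrivial V -> unital V ->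
        isomorphic V (msc_algebra A2) \/ isomorphic V (msc_algebra A4)].
Proof.
have two_neq0 : 2%:R != 0 :> F by move: charF; rewrite inE /=.
split; [split | split | exact: A2_A4_not_isomorphic | ].
- by rewrite dimvf.
- exact: nontrivial_unital_msc.
- exact: unital_unital_msc.
- by rewrite dimvf.
- exact: nontrivial_unital_msc.
- exact: unital_unital_msc.
move=> V dimV [u [u' uu'_neq0]] [e eP].
(* A zero unit would give u u' = e (u u') = 0. *)
have e_neq0 : e != 0.
  apply: contra uu'_neq0 => /eqP e0.
  by rewrite -(eP (amul V u u')).1 e0 (linear0l (amul V)).
have [v v_notin [d vv]] := unital_square_scalar two_neq0 dimV eP e_neq0.
have [d0 | d_neq0] := eqVneq d 0.
  right; apply: (isomorphic_unital_msc two_neq0 dimV eP e_neq0 v_notin).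
  by rewrite vv d0 mul0r.
(* A root c of X^2 - 1/(2d): the default 0 of [nth] supplies the linear coefficient. *)
left; have [c] := solve_monicpoly (nth 0 [:: (2%:R * d)^-1]) (isT : 0 < 2)%N.
rewrite !big_ord_recl big_ord0 /= mulr1 mul0r !addr0 => cc.
have c_neq0 : c != 0.
  by rewrite -sqrf_eq0 cc invr_eq0 mulf_neq0.
(* The rescaled vector has square c^2 d e = (1/2) e, the case t = 1. *)
apply: (@isomorphic_unital_msc _ _ e (c *: v) 1) => //.
  by rewrite rpredZeq (negPf c_neq0).
rewrite (linearZl_LR (amul V)) (linearZr_LR (amul V)) vv !scalerA.
by rewrite -expr2 cc; congr (_ *: _); field; rewrite two_neq0.
Qed.
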